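(* Let $X$ be an infinite compact simple space (with top point $\hat x$) that is cleavable over an infinite ordinal $Y$. If $X$ hereditarily has a spine, then $X$ is homeomorphic to an ordinal.
   Context: A space $X$ is cleavable over $Y$ if for every $A\subseteq X$ there is a continuous $f:X\to Y$ with $f(A)\cap f(X\setminus A)=\emptyset$ ($f$ cleaves along $A$). Ordinals carry the order topology. Derived sets: $X^0=X$, $X^{\alpha+1}=(X^\alpha)'$, $X^\lambda=\bigcap_{\alpha<\lambda}X^\alpha$ for limit $\lambda$; for compact scattered $X$, $\mathrm{CB}(X)=\beta+1$ is a successor and $X^\beta$ is finite, and $X$ is simple with $\hat x$ if $X^\beta=\{\hat x\}$. Let $X$ be infinite, compact, simple with $\hat x$, and cleavable over the infinite ordinal $Y$. A spine of $X$ is a pair $(S,k)$ with $S\subseteq X\setminus\{\hat x\}$ and $k:X\to Y$ continuous such that (1) $k(S)\cap k(X\setminus S)=\emptyset$, (2) $k|_S$ is an embedding into $Y$, (3) $k(S)$ is a closed unbounded subset of the ordinal $k(\hat x)$. $X$ hereditarily has a spine if every closed, infinite, simple subset $A\subseteq X$ (with its own top point, and regarded as cleavable over $Y$) has a spine. *)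

(* Defs.v *)
From Stdlib Require Import List.

Set Implicit Arguments.

Section Topology.
Variable T : Type.
Variable openT : (T -> Prop) -> Prop.

Definition is_topology : Prop :=
  openT (fun _ => True) /\
  (forall U V, openT U -> openT V -> openT (fun x => U x /\ V x)) /\
  (forall F : (T -> Prop) -> Prop, (forall U, F U -> openT U) ->
     openT (fun x => exists U, F U /\ U x)).

Definition closed (A : T -> Prop) : Prop := openT (fun x => ~ A x).

Definition compact : Prop :=
  forall F : (T -> Prop) -> Prop, (forall U, F U -> openT U) ->
    (forall x, exists U, F U /\ U x) ->
    exists l : list (T -> Prop), (forall U, In U l -> F U) /\
      (forall x, exists U, In U l /\ U x).

Definition derived (A : T -> Prop) : T -> Prop :=
  fun x => A x /\ forall U, openT U -> U x -> exists y, y <> x /\ A y /\ U y.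

(** The transfinite derived sets X^alpha: the smallest family containing X,
    closed under derivation and under intersections of nonempty subfamilies.
    (Since the X^alpha form a decreasing chain, this family is exactly
    { X^alpha | alpha ordinal }.) *)
Inductive derived_stage : (T -> Prop) -> Prop :=
| ds_top : derived_stage (fun _ => True)
| ds_der : forall A, derived_stage A -> derived_stage (derived A)
| ds_int : forall P : (T -> Prop) -> Prop,
    (forall A, P A -> derived_stage A) -> (exists A, P A) ->
    derived_stage (fun x => forall A, P A -> A x).

(** compact, (scattered,) with some X^beta = {xh} (hence CB(X) = beta+1) *)
Definition simple (xh : T) : Prop :=
  compact /\ exists S, derived_stage S /\ forall x, S x <-> x = xh.

Definition infinite : Prop := forall l : list T, exists x, ~ In x l.

End Topology.

Definition infinite_type (T : Type) : Prop := forall l : list T, exists x, ~ In x l.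

Definition continuous (X Y : Type) (openX : (X -> Prop) -> Prop)
  (openY : (Y -> Prop) -> Prop) (f : X -> Y) : Prop :=
  forall V, openY V -> openX (fun x => V (f x)).

Definition homeomorphic (X Y : Type) (openX : (X -> Prop) -> Prop)
  (openY : (Y -> Prop) -> Prop) : Prop :=
  exists (f : X -> Y) (g : Y -> X),
    (forall x, g (f x) = x) /\ (forall y, f (g y) = y) /\
    continuous openX openY f /\ continuous openY openX g.

Definition subspace_open (X : Type) (openX : (X -> Prop) -> Prop) (A : X -> Prop)
  : ({x | A x} -> Prop) -> Prop :=
  fun U => exists V, openX V /\ forall a : {x | A x}, U a <-> V (proj1_sig a).

Section Ordinals.
Variable Y : Type.
Variable lt : Y -> Y -> Prop.

Definition is_ordinal : Prop :=
  (forall x, ~ lt x x) /\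
  (forall x y z, lt x y -> lt y z -> lt x z) /\
  (forall x y, lt x y \/ x = y \/ lt y x) /\
  well_founded lt.

Definition le (x y : Y) : Prop := lt x y \/ x = y.

Definition order_open (U : Y -> Prop) : Prop :=
  forall y, U y ->
    ((exists a, lt a y /\ forall z, lt a z -> le z y -> U z) \/
     (forall z, le z y -> U z)) /\
    ((exists b, lt y b /\ forall z, le y z -> lt z b -> U z) \/
     (forall z, le y z -> U z)).

Definition is_limit (alpha : Y) : Prop :=
  (exists y, lt y alpha) /\ forall y, lt y alpha -> exists z, lt y z /\ lt z alpha.

Definition club_in (C : Y -> Prop) (alpha : Y) : Prop :=
  is_limit alpha /\
  (forall y, C y -> lt y alpha) /\
  (forall y, lt y alpha -> exists z, C z /\ le y z) /\
  (exists F, closed order_open F /\ forall y, lt y alpha -> (C y <-> F y)).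

End Ordinals.

Definition cleavable (X Y : Type) (openX : (X -> Prop) -> Prop)
  (openY : (Y -> Prop) -> Prop) : Prop :=
  forall A : X -> Prop, exists f : X -> Y, continuous openX openY f /\
    forall a b, A a -> ~ A b -> f a <> f b.

Definition embedding_on (X Y : Type) (openX : (X -> Prop) -> Prop)
  (openY : (Y -> Prop) -> Prop) (S : X -> Prop) (k : X -> Y) : Prop :=
  (forall a b, S a -> S b -> k a = k b -> a = b) /\
  (forall U, openX U -> exists V, openY V /\ forall s, S s -> (U s <-> V (k s))).

Definition has_spine (X Y : Type) (openX : (X -> Prop) -> Prop)
  (ltY : Y -> Y -> Prop) (xh : X) : Prop :=
  exists (S : X -> Prop) (k : X -> Y),
    (forall x, S x -> x <> xh) /\
    continuous openX (order_open ltY) k /\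
    (forall a b, S a -> ~ S b -> k a <> k b) /\
    embedding_on openX (order_open ltY) S k /\
    club_in ltY (fun y => exists s, S s /\ k s = y) (k xh).

Definition hereditarily_has_spine (X Y : Type) (openX : (X -> Prop) -> Prop)
  (ltY : Y -> Y -> Prop) : Prop :=
  forall A : X -> Prop, closed openX A -> infinite_type {x | A x} ->
    forall a : {x | A x}, simple (subspace_open openX A) a ->
      has_spine (subspace_open openX A) ltY a.

(* Main.v *)
(** Scatteredness reduces the theorem to a local statement: if every point other than [x]
    of some neighbourhood of [x] has a clopen neighbourhood that is an ordinal, then so does
    [x]. For this it suffices to find a continuous map [X -> Y] whose fibre at [x] is [{x}]
    and all of whose fibres are open or singletons: ordering [X] first by the value of the
    map and then inside each fibre gives a well-order with open rays, and compactness
    identifies its topology with that of [X].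

    Among the continuous [f : X -> Y] with maximum [a = f x] attained only at [x], take one
    with [a] minimal; then [a] is regular. If [a] has countable cofinality, no fibre below
    [a] lies over a limit, so all of them are open. If [a] has uncountable cofinality,
    split it into two stationary sets and cleave along sets that contain all points over
    one stationary set and all but one chosen boundary point [s xi] of [f < xi] over the
    other. This shows that for club many [xi] the set [{f < xi} U {s xi}] is clopen, and
    sending [z] to the least such [xi] with [z] in that set is the required map. *)

Require Import Defs.
From Stdlib Require Import List PeanoNat Classical ClassicalEpsilon FunctionalExtensionality
  PropExtensionality.

(** * Choice functions *)

Lemma choice_fun (A B : Type) (R : A -> B -> Prop) :
  (forall a, exists b, R a b) -> exists f : A -> B, forall a, R a (f a).
Proof.
  intros H.
  exists (fun a => proj1_sig (constructive_indefinite_description _ (H a))).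
  intros a. exact (proj2_sig (constructive_indefinite_description _ (H a))).
Qed.

(** The default [b0] serves the arguments outside [D], so the chosen function is total. *)
Lemma choice_fun_dom (A B : Type) (b0 : B) (D : A -> Prop) (R : A -> B -> Prop) :
  (forall a, D a -> exists b, R a b) -> exists f : A -> B, forall a, D a -> R a (f a).
Proof.
  intros H. apply choice_fun with (R := fun a b => D a -> R a b).
  intros a. destruct (classic (D a)) as [Da|nDa].
  - destruct (H a Da) as [b Hb]. now exists b.
  - now exists b0.
Qed.

(** * Order and order topology of an ordinal *)

Section LinearOrder.
Variables (Y : Type) (lt : Y -> Y -> Prop).
Hypothesis ord : is_ordinal lt.
Local Notation "x < y" := (lt x y).
Local Notation "x <= y" := (le lt x y).

Lemma lt_irrefl x : ~ x < x.
Proof. apply ord. Qed.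

Lemma lt_trans x y z : x < y -> y < z -> x < z.
Proof. apply ord. Qed.

Lemma lt_total x y : x < y \/ x = y \/ y < x.
Proof. apply ord. Qed.

Lemma lt_le x y : x < y -> x <= y.
Proof. now left. Qed.

Lemma le_refl x : x <= x.
Proof. now right. Qed.

Lemma lt_le_trans x y z : x < y -> y <= z -> x < z.
Proof. intros H [H'| <-]; trivial. now apply lt_trans with y. Qed.

Lemma le_lt_trans x y z : x <= y -> y < z -> x < z.
Proof. intros [H| ->]; trivial. now apply lt_trans. Qed.

Lemma le_trans x y z : x <= y -> y <= z -> x <= z.
Proof. intros [H| ->] H'; trivial. left. now apply lt_le_trans with y. Qed.

Lemma le_not_lt x y : x <= y -> ~ y < x.
Proof. intros H H'. apply (lt_irrefl x). now apply le_lt_trans with y. Qed.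

Lemma lt_not_le x y : x < y -> ~ y <= x.
Proof. intros H H'. now apply (le_not_lt y x). Qed.

Lemma le_or_lt x y : x <= y \/ y < x.
Proof. destruct (lt_total x y) as [H|[H|H]]; unfold le; tauto. Qed.

Lemma not_lt_le x y : ~ y < x -> x <= y.
Proof. destruct (le_or_lt x y); tauto. Qed.

Lemma not_le_lt x y : ~ x <= y -> y < x.
Proof. destruct (le_or_lt x y); tauto. Qed.

Lemma max_exists x y : exists m, x <= m /\ y <= m /\ (m = x \/ m = y).
Proof.
  destruct (le_or_lt x y) as [H|H].
  - exists y. auto using le_refl.
  - exists x. auto using le_refl, lt_le.
Qed.

Lemma least_exists (P : Y -> Prop) :
  (exists y, P y) -> exists y, P y /\ forall z, P z -> y <= z.
Proof.
  intros [y Py]. assert (wf : well_founded lt) by apply ord.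
  induction (wf y) as [y _ IH].
  destruct (classic (exists z, P z /\ z < y)) as [[z [Pz zy]]|H].
  - now apply IH with z.
  - exists y. split; trivial. intros z Pz. apply not_lt_le. intros zy. apply H. now exists z.
Qed.

Lemma order_open_lt c : order_open lt (fun z => z < c).
Proof.
  intros y yc. split.
  - right. intros z zy. now apply le_lt_trans with y.
  - left. now exists c.
Qed.

Lemma order_open_gt c : order_open lt (fun z => c < z).
Proof.
  intros y yc. split.
  - left. now exists c.
  - right. intros z zy. now apply lt_le_trans with y.
Qed.

(** In a well-order [c] is either the last element or has an immediate successor, and the ray below
    that successor is the closed ray ending at [c]. *)
Lemma order_open_le c : order_open lt (fun z => z <= c).
Proof.
  intros y yc. split.
  - right. intros z zy. now apply le_trans with y.
  - destruct (classic (exists b, c < b)) as [H|H].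
    + destruct (least_exists _ H) as [b [cb Hb]].
      left. exists b. split.
      * now apply le_lt_trans with c.
      * intros z _ zb. apply not_lt_le. intros cz.
        now apply (lt_not_le z b); [|apply Hb].
    + right. intros z _. apply not_lt_le. intros cz. apply H. now exists z.
Qed.

End LinearOrder.

Arguments lt_irrefl {Y lt} ord.
Arguments lt_trans {Y lt} ord.
Arguments lt_total {Y lt} ord.
Arguments lt_le {Y lt}.
Arguments le_refl {Y lt}.
Arguments lt_le_trans {Y lt} ord.
Arguments le_lt_trans {Y lt} ord.
Arguments le_trans {Y lt} ord.
Arguments le_not_lt {Y lt} ord.
Arguments lt_not_le {Y lt} ord.
Arguments le_or_lt {Y lt} ord.
Arguments not_lt_le {Y lt} ord.
Arguments not_le_lt {Y lt} ord.
Arguments max_exists {Y lt} ord.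
Arguments least_exists {Y lt} ord.
Arguments order_open_lt {Y lt} ord.
Arguments order_open_gt {Y lt} ord.
Arguments order_open_le {Y lt} ord.

(** * Open and clopen sets *)

Section Space.
Variables (X : Type) (openX : (X -> Prop) -> Prop).
Hypothesis top : is_topology openX.

Lemma open_ext (U V : X -> Prop) : openX U -> (forall x, U x <-> V x) -> openX V.
Proof.
  intros HU H. replace V with U; trivial.
  apply functional_extensionality. intros x. now apply propositional_extensionality.
Qed.

Lemma open_full : openX (fun _ => True).
Proof. apply top. Qed.

Lemma open_and U V : openX U -> openX V -> openX (fun x => U x /\ V x).
Proof. apply top. Qed.

Lemma open_local (U : X -> Prop) :
  (forall x, U x -> exists V, openX V /\ V x /\ forall z, V z -> U z) -> openX U.
Proof.
  intros H. destruct top as [_ [_ Hu]].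
  apply open_ext with
    (fun x => exists V, (openX V /\ forall z, V z -> U z) /\ V x).
  - apply (Hu (fun V => openX V /\ forall z, V z -> U z)). tauto.
  - intros x. split.
    + intros [V [[_ HV] Vx]]. auto.
    + intros Ux. destruct (H x Ux) as [V HV]. exists V. tauto.
Qed.

Lemma open_or U V : openX U -> openX V -> openX (fun x => U x \/ V x).
Proof.
  intros HU HV. apply open_local. intros x [H|H]; [exists U|exists V]; auto.
Qed.

Lemma open_empty : openX (fun _ => False).
Proof. apply open_local. tauto. Qed.

Definition clopen (U : X -> Prop) : Prop := openX U /\ closed openX U.

Lemma clopen_ext U V : clopen U -> (forall x, U x <-> V x) -> clopen V.
Proof.
  intros [H H'] E. split.
  - now apply open_ext with U.
  - apply open_ext with (1 := H'). intros x. specialize (E x). tauto.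
Qed.

Lemma clopen_and U V : clopen U -> clopen V -> clopen (fun x => U x /\ V x).
Proof.
  intros [HU HU'] [HV HV']. split.
  - now apply open_and.
  - apply open_ext with (1 := open_or _ _ HU' HV'). intros x. tauto.
Qed.

Lemma clopen_or U V : clopen U -> clopen V -> clopen (fun x => U x \/ V x).
Proof.
  intros [HU HU'] [HV HV']. split.
  - now apply open_or.
  - apply open_ext with (1 := open_and _ _ HU' HV'). intros x. tauto.
Qed.

Lemma clopen_not U : clopen U -> clopen (fun x => ~ U x).
Proof.
  intros [HU HU']. split; trivial.
  apply open_ext with (1 := HU). intros x. tauto.
Qed.

Lemma clopen_full : clopen (fun _ => True).
Proof.
  split; [apply open_full|]. apply open_ext with (1 := open_empty). tauto.
Qed.

Lemma clopen_empty : clopen (fun _ => False).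
Proof. apply clopen_ext with (1 := clopen_not _ clopen_full). tauto. Qed.

(** * Continuous maps into an ordinal *)

Section ContinuousIntoOrdinal.
Variables (Y : Type) (lt : Y -> Y -> Prop).
Hypothesis ord : is_ordinal lt.
Local Notation "x < y" := (lt x y).
Local Notation "x <= y" := (le lt x y).
Local Notation cont := (continuous openX (order_open lt)).

Lemma continuous_open_lt h c : cont h -> openX (fun x => h x < c).
Proof. intros H. apply (H (fun z => z < c)). now apply order_open_lt. Qed.

Lemma continuous_open_gt h c : cont h -> openX (fun x => c < h x).
Proof. intros H. apply (H (fun z => c < z)). now apply order_open_gt. Qed.

Lemma continuous_clopen_le h c : cont h -> clopen (fun x => h x <= c).
Proof.
  intros H. split.
  - apply (H (fun z => z <= c)). now apply order_open_le.
  - apply open_ext with (1 := continuous_open_gt h c H). intros x. split.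
    + now apply lt_not_le.
    + now apply not_le_lt.
Qed.

Lemma continuous_clopen_gt h c : cont h -> clopen (fun x => c < h x).
Proof.
  intros H. apply clopen_ext with (1 := clopen_not _ (continuous_clopen_le h c H)).
  intros x. split.
  - now apply not_le_lt.
  - now apply lt_not_le.
Qed.

Lemma continuous_of_rays h :
  (forall c, openX (fun x => h x < c)) -> (forall c, openX (fun x => c < h x)) -> cont h.
Proof.
  intros Hlt Hgt V HV. apply open_local. intros x Vx.
  destruct (HV _ Vx) as [Hl Hr].
  assert (Ll : exists L, openX L /\ L x /\ forall z, L z -> h z <= h x -> V (h z)).
  { destruct Hl as [[a [ax Ha]]|Ha].
    - exists (fun z => a < h z). auto.
    - exists (fun _ => True). auto using open_full. }
  assert (Rr : exists R, openX R /\ R x /\ forall z, R z -> h x <= h z -> V (h z)).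
  { destruct Hr as [[a [ax Ha]]|Ha].
    - exists (fun z => h z < a). auto.
    - exists (fun _ => True). auto using open_full. }
  destruct Ll as [L [oL [Lx HL]]], Rr as [R [oR [Rx HR]]].
  exists (fun z => L z /\ R z). split; [now apply open_and|]. split; [now split|].
  intros z [Lz Rz]. destruct (le_or_lt ord (h z) (h x)) as [H|H]; auto using lt_le.
Qed.

(** The open ray below [c] is the union of the closed rays ending at values of [h] below [c], and
    the ray above [c] is a complement. *)
Lemma continuous_of_clopen_le h : (forall c, clopen (fun x => h x <= c)) -> cont h.
Proof.
  intros H. apply continuous_of_rays.
  - intros c. apply open_local. intros x hx.
    exists (fun z => h z <= h x). split; [apply H|]. split; [apply le_refl|].
    intros z hz. now apply le_lt_trans with (h x).
  - intros c. apply open_ext with (1 := proj2 (H c)). intros x. split.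
    + now apply not_le_lt.
    + now apply lt_not_le.
Qed.

(** The open sets [F <= c] with [c < a] cover [K]; a finite subcover has a largest index. Empty [K]
    is a separate case because [a] may be the least element. *)
Lemma continuous_bounded_on_closed F K a :
  compact openX -> cont F -> closed openX K -> (forall z, K z -> F z < a) ->
  (forall z, ~ K z) \/ exists b, b < a /\ forall z, K z -> F z <= b.
Proof.
  intros comp cF cK HK.
  set (Fam := fun U : X -> Prop =>
    U = (fun z => ~ K z) \/ exists c, c < a /\ U = (fun z => F z <= c)).
  destruct (comp Fam) as [l [lF lC]].
  - intros U [->|[c [_ ->]]]; trivial. now apply continuous_clopen_le.
  - intros x. destruct (classic (K x)) as [Kx|Kx].
    + exists (fun z => F z <= F x). split; [|apply le_refl].
      right. exists (F x). auto.
    + exists (fun z => ~ K z). split; trivial. now left.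
  - assert (H : (forall U z, In U l -> K z -> ~ U z) \/
                exists b, b < a /\ forall U z, In U l -> K z -> U z -> F z <= b).
    { clear lC. induction l as [|U l IH].
      - left. intros U z [].
      - destruct IH as [IH|[b [ba Hb]]].
        + intros V HV. apply lF. now right.
        + destruct (lF U (or_introl eq_refl)) as [->|[c [ca ->]]].
          * left. intros V z [<-|HV] Kz; [tauto|]. now apply IH.
          * right. exists c. split; trivial. intros V z [<-|HV] Kz Vz; trivial.
            now destruct (IH V z HV Kz).
        + right. destruct (lF U (or_introl eq_refl)) as [->|[c [ca ->]]].
          * exists b. split; trivial. intros V z [<-|HV] Kz Vz; [tauto|].
            now apply Hb with V.
          * destruct (max_exists ord b c) as [m [bm [cm Hm]]]. exists m. split.
            -- now destruct Hm as [->| ->].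
            -- intros V z [<-|HV] Kz Vz.
               ++ now apply le_trans with c.
               ++ apply le_trans with b; trivial. now apply Hb with V. }
    destruct H as [H|[b [ba H]]].
    + left. intros z Kz. destruct (lC z) as [U [lU Uz]]. now apply (H U z).
    + right. exists b. split; trivial. intros z Kz.
      destruct (lC z) as [U [lU Uz]]. now apply (H U z).
Qed.

End ContinuousIntoOrdinal.
End Space.

Arguments clopen {X}.
Arguments open_ext {X openX}.
Arguments open_full {X openX} top.
Arguments open_local {X openX} top.
Arguments clopen_ext {X openX}.
Arguments clopen_not {X openX}.
Arguments clopen_full {X openX} top.
Arguments clopen_empty {X openX} top.
Arguments continuous_open_lt {X openX Y lt} ord.
Arguments continuous_open_gt {X openX Y lt} ord.
Arguments continuous_clopen_le {X openX Y lt} ord.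
Arguments continuous_clopen_gt {X openX Y lt} ord.
Arguments continuous_of_rays {X openX} top {Y lt} ord.
Arguments continuous_bounded_on_closed {X openX Y lt} ord.

(** * Club filter of a regular ordinal of uncountable cofinality *)

Section Club.
Variables (Y : Type) (lt : Y -> Y -> Prop) (a : Y).
Hypothesis ord : is_ordinal lt.
Local Notation "x < y" := (lt x y).
Local Notation "x <= y" := (le lt x y).

Definition regular : Prop :=
  forall (g : Y) (h : Y -> Y), g < a -> (forall c, c < g -> h c < a) ->
    exists b, b < a /\ forall c, c < g -> h c <= b.

Definition uncountable_cofinality : Prop :=
  forall h : nat -> Y, (forall n, h n < a) -> exists b, b < a /\ forall n, h n <= b.

Definition closed_under (phi : Y -> Y) (xi : Y) : Prop :=
  (exists y, y < xi) /\ forall y, y < xi -> phi y < xi.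

(* The sets [closed_under phi] generate the club filter of a regular uncountable [a]. *)
Definition almost_all (P : Y -> Prop) : Prop :=
  exists phi, (forall y, y < a -> phi y < a) /\
    forall xi, xi < a -> closed_under phi xi -> P xi.

(** Successors qualify through constant sequences, so this means nonzero cofinality at most
    omega. *)
Definition cofinality_omega (xi : Y) : Prop :=
  exists t : nat -> Y, (forall n, t n < xi) /\ forall y, y < xi -> exists n, y <= t n.

Lemma almost_all_mono (P Q : Y -> Prop) :
  (forall xi, xi < a -> P xi -> Q xi) -> almost_all P -> almost_all Q.
Proof. intros H [phi [Hphi HP]]. exists phi. auto. Qed.

Hypothesis lim : is_limit lt a.
Hypothesis reg : regular.
Hypothesis unc : uncountable_cofinality.

Lemma regular_le (g : Y) (h : Y -> Y) :
  g < a -> (forall c, c <= g -> h c < a) -> exists b, b < a /\ forall c, c <= g -> h c <= b.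
Proof.
  intros ga Hh. destruct (reg g h ga) as [b [ba Hb]].
  - intros c cg. apply Hh. now left.
  - destruct (max_exists ord b (h g)) as [m [bm [gm Hm]]]. exists m. split.
    + destruct Hm as [->| ->]; trivial. apply Hh, le_refl.
    + intros c [cg| ->]; trivial. apply (le_trans ord) with b; auto.
Qed.

(** Iterate from [y0] a step that exceeds [u] and all values of [phi] up to [u]; regularity keeps
    each step below [a]. The supremum of the iterates is closed under [phi], and uncountable
    cofinality keeps it below [a]. *)
Lemma closed_under_unbounded phi y0 :
  (forall y, y < a -> phi y < a) -> y0 < a ->
  exists xi, xi < a /\ y0 < xi /\ closed_under phi xi /\ cofinality_omega xi.
Proof.
  intros Hphi y0a.
  destruct (choice_fun_dom _ _ y0 (fun u => u < a)
    (fun u v => v < a /\ u < v /\ forall y, y <= u -> phi y < v)) as [nxt Hn].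
  { intros u ua. destruct (regular_le u phi ua) as [b [ba Hb]].
    - intros c cu. apply Hphi. now apply (le_lt_trans ord) with u.
    - destruct (max_exists ord b u) as [m [bm [um Hm]]].
      assert (ma : m < a) by now destruct Hm as [->| ->].
      destruct (proj2 lim m ma) as [v [mv va]].
      exists v. split; trivial. split; [now apply (le_lt_trans ord) with m|].
      intros y yu. apply (le_lt_trans ord) with m; trivial.
      apply (le_trans ord) with b; auto. }
  set (t := fun n => Nat.iter n nxt y0).
  assert (ta : forall n, t n < a).
  { intros n. induction n as [|n IH]; trivial. now apply (Hn (t n)). }
  destruct (unc t ta) as [b [ba Hb]].
  destruct (least_exists ord (fun y => forall n, t n < y)) as [xi [xi1 xi2]].
  { destruct (proj2 lim b ba) as [v [bv va]]. exists v.
    intros n. now apply (le_lt_trans ord) with b. }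
  assert (cof : forall y, y < xi -> exists n, y <= t n).
  { intros y yx. apply NNPP. intros H. apply (lt_not_le ord y xi); trivial.
    apply xi2. intros n. apply (not_le_lt ord). intros yt. apply H. now exists n. }
  exists xi. split; [|split; [apply (xi1 0)|split; [split|]]].
  - destruct (proj2 lim b ba) as [v [bv va]].
    apply (le_lt_trans ord) with v; trivial. apply xi2.
    intros n. now apply (le_lt_trans ord) with b.
  - exists (t 0). auto.
  - intros y yx. destruct (cof y yx) as [n yn].
    apply (lt_trans ord) with (t (S n)); trivial. now apply (Hn (t n)).
  - now exists t.
Qed.

Lemma almost_all_not_false : ~ almost_all (fun _ => False).
Proof.
  intros [phi [Hphi HP]]. destruct (proj1 lim) as [y0 y0a].
  destruct (closed_under_unbounded phi y0 Hphi y0a) as [xi [xa [_ [cl _]]]].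
  now apply (HP xi).
Qed.

Lemma almost_all_gt b : b < a -> almost_all (fun xi => b < xi).
Proof.
  intros ba. exists (fun _ => b). split; trivial. intros xi _ [[y yx] H]. now apply (H y).
Qed.

(** A pointwise bound [psi] of countably many functions stays below [a] by uncountable cofinality,
    and closure under [psi] implies closure under each of them. *)
Lemma almost_all_countable (P : nat -> Y -> Prop) :
  (forall n, almost_all (P n)) -> almost_all (fun xi => forall n, P n xi).
Proof.
  intros H. destruct (choice_fun _ _ _ H) as [phi Hphi].
  destruct (choice_fun_dom _ _ a (fun y => y < a)
    (fun y b => b < a /\ forall n, phi n y <= b)) as [psi Hpsi].
  { intros y ya. apply unc. intros n. now apply Hphi. }
  exists psi. split.
  - intros y ya. now apply Hpsi.
  - intros xi xa [ne cl] n. apply Hphi; trivial. split; trivial.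
    intros y yx. apply (le_lt_trans ord) with (psi y); auto.
    apply Hpsi. now apply (lt_trans ord) with xi.
Qed.

Lemma almost_all_and P Q :
  almost_all P -> almost_all Q -> almost_all (fun xi => P xi /\ Q xi).
Proof.
  intros HP HQ.
  apply almost_all_mono with (fun xi => forall n : nat, match n with O => P xi | _ => Q xi end).
  - intros xi _ H. split; [apply (H 0)|apply (H 1)].
  - apply almost_all_countable. now intros [|n].
Qed.

(** Normality of the club filter. Regularity, applied twice, gives [psi y] bounding all [phi c y']
    with both arguments at most [y]; closure under [psi] then yields closure under [phi c] for every
    [c] below [xi]. *)
Lemma almost_all_diagonal (P : Y -> Y -> Prop) :
  (forall c, c < a -> almost_all (P c)) ->
  almost_all (fun xi => forall c, c < xi -> P c xi).
Proof.
  intros H. destruct (choice_fun_dom _ _ (fun y : Y => y) _ _ H) as [phi Hphi].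
  destruct (choice_fun_dom _ _ a (fun y => y < a)
    (fun y b => b < a /\ forall c y', c <= y -> y' <= y -> phi c y' <= b)) as [psi Hpsi].
  { intros y ya.
    destruct (choice_fun_dom _ _ a (fun c => c <= y)
      (fun c b => b < a /\ forall y', y' <= y -> phi c y' <= b)) as [bd Hbd].
    - intros c cy. apply regular_le; trivial. intros y' yy'.
      apply Hphi; now apply (le_lt_trans ord) with y.
    - destruct (regular_le y bd ya) as [b [ba Hb]].
      + intros c cy. now apply Hbd.
      + exists b. split; trivial. intros c y' cy yy'.
        apply (le_trans ord) with (bd c); auto. now apply Hbd. }
  exists psi. split.
  - intros y ya. now apply Hpsi.
  - intros xi xa [ne cl] c cx. apply Hphi; trivial.
    + now apply (lt_trans ord) with xi.
    + split; trivial. intros y yx.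
      destruct (max_exists ord c y) as [m [cm [ym Hm]]].
      assert (mx : m < xi) by now destruct Hm as [->| ->].
      apply (le_lt_trans ord) with (psi m); auto.
      apply Hpsi; trivial. now apply (lt_trans ord) with xi.
Qed.

(* Unless the points of cofinality [omega] already form such a set, almost every point
   has a ladder of type [omega]; if no set split the club filter, pressing down would bound
   the n-th rung by a constant almost everywhere, for all n at once. *)
Lemma stationary_costationary_exists :
  exists T : Y -> Prop, ~ almost_all T /\ ~ almost_all (fun xi => ~ T xi).
Proof.
  apply NNPP. intros none.
  assert (dich : forall T, almost_all T \/ almost_all (fun xi => ~ T xi)).
  { intros T. apply NNPP. intros H. apply none. exists T. tauto. }
  destruct (dich cofinality_omega) as [Hw|[phi [Hphi Hw]]].
  2:{ destruct (proj1 lim) as [y0 y0a].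
      destruct (closed_under_unbounded phi y0 Hphi y0a) as [xi [xa [_ [cl cw]]]].
      now apply (Hw xi). }
  destruct (choice_fun_dom _ _ (fun _ : nat => a) cofinality_omega
    (fun xi t => (forall n, t n < xi) /\ forall y, y < xi -> exists n, y <= t n)
    (fun xi H => H)) as [ladder Hl].
  (* Pressing down: if every constant failed, [dich] would make each fail almost everywhere, and the
     diagonal intersection would contradict [ladder xi n < xi]. *)
  assert (Hc : forall n, exists c, c < a /\ almost_all (fun xi => ladder xi n <= c)).
  { intros n. apply NNPP. intros H. apply almost_all_not_false.
    apply almost_all_mono with
      (fun xi => cofinality_omega xi /\ forall c, c < xi -> ~ ladder xi n <= c).
    - intros xi _ [cw Hx]. apply (Hx (ladder xi n)); [|apply le_refl]. now apply Hl.
    - apply almost_all_and; trivial. apply almost_all_diagonal. intros c ca.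
      destruct (dich (fun xi => ladder xi n <= c)) as [D|D]; trivial.
      destruct H. now exists c. }
  destruct (choice_fun _ _ _ Hc) as [c Hc'].
  destruct (unc c) as [b [ba Hb]]; [intros n; apply Hc'|].
  (* A point strictly above all the constants: a ladder cofinal in some [xi] above [b'] must reach
     [b'], yet all its rungs are at most [b]. *)
  destruct (proj2 lim b ba) as [b' [bb' b'a]].
  apply almost_all_not_false.
  apply almost_all_mono with
    (fun xi => (cofinality_omega xi /\ b' < xi) /\ forall n, ladder xi n <= c n).
  - intros xi _ [[cw bx] Hn]. destruct (Hl xi cw) as [_ cof].
    destruct (cof b' bx) as [n Hbn]. apply (lt_not_le ord b b'); trivial.
    apply (le_trans ord) with (ladder xi n); trivial. apply (le_trans ord) with (c n); auto.
  - apply almost_all_and; [apply almost_all_and; trivial; now apply almost_all_gt|].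
    apply almost_all_countable. intros n. apply Hc'.
Qed.

End Club.

Arguments regular {Y}.
Arguments uncountable_cofinality {Y}.
Arguments closed_under {Y}.
Arguments almost_all {Y}.

(** * Maps isolating a point, and peaks *)

Section FineMap.
Variables (X : Type) (openX : (X -> Prop) -> Prop).
Hypothesis top : is_topology openX.
Hypothesis comp : compact openX.
Variables (Y : Type) (lt : Y -> Y -> Prop).
Hypothesis ord : is_ordinal lt.
Hypothesis cleav : cleavable openX (order_open lt).
Local Notation "x < y" := (lt x y).
Local Notation "x <= y" := (le lt x y).
Local Notation cont := (continuous openX (order_open lt)).

Lemma continuous_restrict_clopen (A : X -> Prop) f y0 :
  clopen openX A -> cont f ->
  cont (fun z => if excluded_middle_informative (A z) then f z else y0).
Proof.
  intros cA cf. apply continuous_of_clopen_le; trivial. intros c.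
  apply clopen_ext with (fun z => (A z /\ f z <= c) \/ (~ A z /\ y0 <= c)).
  - apply clopen_or; trivial.
    + apply clopen_and; trivial. now apply continuous_clopen_le.
    + destruct (classic (y0 <= c)) as [H|H].
      * apply clopen_ext with (1 := clopen_not _ cA). tauto.
      * apply clopen_ext with (1 := clopen_empty top). tauto.
  - intros z. destruct (excluded_middle_informative (A z)); tauto.
Qed.

Variable x : X.

Definition isolates (f : X -> Y) : Prop := cont f /\ forall z, f z = f x -> z = x.

Lemma isolating_map_exists : exists f, isolates f.
Proof.
  destruct (cleav (fun z => z = x)) as [f [cf Hf]]. exists f. split; trivial.
  intros z fz. apply NNPP. intros H. now apply (Hf x z).
Qed.

Hypothesis nonisolated : ~ openX (fun z => z = x).

Definition peaks (f : X -> Y) : Prop := isolates f /\ forall z, f z <= f x.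

Lemma peak_exists : exists f, peaks f.
Proof.
  destruct isolating_map_exists as [f [cf Hf]].
  (* If [f x] were the least element, [f <= f x] would be an open set equal to the singleton of
     [x]. *)
  assert (H : exists y0, y0 < f x).
  { apply NNPP. intros H. apply nonisolated.
    apply open_ext with (1 := proj1 (continuous_clopen_le ord _ (f x) cf)).
    intros z. split.
    - intros [L|L]; auto. destruct H. now exists (f z).
    - intros ->. apply le_refl. }
  destruct H as [y0 Hy0].
  (* Values above [f x] collapse to [y0], strictly below [f x], so the fibre at [x] does not
     grow. *)
  exists (fun z => if excluded_middle_informative (f z <= f x) then f z else y0).
  split; [split|].
  - apply continuous_restrict_clopen; trivial. now apply continuous_clopen_le.
  - intros z. destruct (excluded_middle_informative (f x <= f x)) as [_|n].
    2:{ destruct n. apply le_refl. }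
    destruct (excluded_middle_informative (f z <= f x)) as [L|L]; auto.
    intros E. rewrite E in Hy0. now destruct (lt_irrefl ord (f x)).
  - intros z. destruct (excluded_middle_informative (f x <= f x)) as [_|n].
    2:{ destruct n. apply le_refl. }
    destruct (excluded_middle_informative (f z <= f x)) as [L|L]; trivial. now left.
Qed.

Lemma minimal_peak_exists : exists f, peaks f /\ forall g, peaks g -> f x <= g x.
Proof.
  destruct (least_exists ord (fun y => exists f, peaks f /\ f x = y)) as [y [[f [pf <-]] H]].
  - destruct peak_exists as [f pf]. exists (f x), f. auto.
  - exists f. split; trivial. intros g pg. apply H. now exists g.
Qed.

(** * Peaks of minimal height *)

Section MinimalPeak.
Variable f : X -> Y.
Hypothesis peak : peaks f.
Hypothesis minimal : forall g, peaks g -> f x <= g x.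

Let cf : cont f := proj1 (proj1 peak).

Lemma peak_lt z : z <> x -> f z < f x.
Proof.
  intros zx. pose proof peak as [[_ H] L]. destruct (L z) as [|E]; trivial.
  now destruct (zx (H z E)).
Qed.

Lemma lt_peak_neq z : f z < f x -> z <> x.
Proof. intros H ->. now apply (lt_irrefl ord (f x)). Qed.

(** Otherwise the open set [y < f] would contain [x] alone. *)
Lemma peak_not_locally_bounded y : y < f x -> exists z, z <> x /\ y < f z.
Proof.
  intros yx. apply NNPP. intros H. apply nonisolated.
  apply open_ext with (1 := continuous_open_gt ord _ y cf).
  intros z. split.
  - intros yz. apply NNPP. intros zx. apply H. now exists z.
  - now intros ->.
Qed.

Lemma peak_is_limit : is_limit lt (f x).
Proof.
  split.
  - apply NNPP. intros H. apply nonisolated.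
    apply open_ext with (1 := open_full top). intros z. split; trivial.
    intros _. apply NNPP. intros zx. apply H. exists (f z). now apply peak_lt.
  - intros y yx. destruct (peak_not_locally_bounded y yx) as [z [zx yz]].
    exists (f z). split; trivial. now apply peak_lt.
Qed.

(* An unbounded function on a smaller ordinal [g] would collapse [f] to a map peaking
   at [g]. *)
Lemma minimal_peak_regular : regular lt (f x).
Proof.
  set (bad := fun g => g < f x /\ exists h : Y -> Y, (forall c, c < g -> h c < f x) /\
    forall b, b < f x -> exists c, c < g /\ b < h c).
  assert (key : ~ exists g, bad g).
  { intros ex. destruct (least_exists ord bad ex) as [g [[ga [h [ha hu]]] gmin]].
    (* [H c] is the supremum of [h] over [c' <= c]. Minimality of [g] bounds [h] on the segment
       below [c], so the supremum stays below [f x]. *)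
    destruct (choice_fun_dom _ _ g (fun c => c < g)
      (fun c v => v < f x /\ (forall c', c' <= c -> h c' <= v) /\
         forall y, (forall c', c' <= c -> h c' <= y) -> v <= y)) as [H HH].
    { intros c cg.
      assert (B : exists b, b < f x /\ forall c', c' < c -> h c' <= b).
      { apply NNPP. intros nB. apply (lt_not_le ord c g cg). apply gmin.
        split; [now apply (lt_trans ord) with g|]. exists h. split.
        - intros c' cc'. apply ha. now apply (lt_trans ord) with c.
        - intros b ba. apply NNPP. intros nc. apply nB. exists b. split; trivial.
          intros c' cc'. apply (not_lt_le ord). intros bh. apply nc. now exists c'. }
      destruct B as [b [ba Hb]].
      destruct (max_exists ord b (h c)) as [m [bm [hm Hm]]].
      assert (ub : forall c', c' <= c -> h c' <= m).
      { intros c' [L| ->]; trivial. apply (le_trans ord) with b; auto. }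
      destruct (least_exists ord (fun y => forall c', c' <= c -> h c' <= y)) as [v [v1 v2]].
      - now exists m.
      - exists v. split; [|now split]. apply (le_lt_trans ord) with m; auto.
        destruct Hm as [->| ->]; auto. }
    assert (Hmono : forall c c', c <= c' -> c' < g -> H c <= H c').
    { intros c c' L cg. apply HH; [now apply (le_lt_trans ord) with c'|].
      intros d dc. apply HH; trivial. now apply (le_trans ord) with c. }
    (* [r z] is the first [c < g] with [f z <= H c], or [g] if there is none. For [c < g] the set
       [r <= c] equals [f <= H c], whence continuity; unboundedness of [h] leaves only [x] over
       [g]. *)
    destruct (choice_fun _ _ (fun z c => (c = g \/ (c < g /\ f z <= H c)) /\
      forall c', (c' = g \/ (c' < g /\ f z <= H c')) -> c <= c')) as [r Hr].
    { intros z. apply (least_exists ord (fun c => c = g \/ (c < g /\ f z <= H c))).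
      exists g. now left. }
    assert (rle : forall z, r z <= g).
    { intros z. apply Hr. now left. }
    assert (rx : r x = g).
    { destruct (proj1 (Hr x)) as [E|[L L']]; trivial.
      destruct (le_not_lt ord _ _ L'). now apply HH. }
    apply (lt_not_le ord g (f x) ga). rewrite <- rx. apply minimal. split; [split|].
    - apply continuous_of_clopen_le; trivial. intros c.
      destruct (le_or_lt ord g c) as [gc|cg].
      + apply clopen_ext with (1 := clopen_full top). intros z. split; trivial.
        intros _. now apply (le_trans ord) with g.
      + apply clopen_ext with (1 := continuous_clopen_le ord _ (H c) cf).
        intros z. split.
        * intros L. apply Hr. now right.
        * intros L. destruct (proj1 (Hr z)) as [E|[L1 L2]].
          -- rewrite E in L. now destruct (lt_not_le ord c g).
          -- apply (le_trans ord) with (H (r z)); auto.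
    - rewrite rx. intros z E. apply NNPP. intros zx.
      destruct (hu (f z) (peak_lt z zx)) as [c [cg fc]].
      apply (lt_not_le ord c g cg). rewrite <- E. apply Hr. right. split; trivial.
      left. apply (lt_le_trans ord) with (h c); trivial. apply HH; trivial. apply le_refl.
    - now rewrite rx. }
  intros g h ga ha. apply NNPP. intros nb. apply key. exists g. split; trivial.
  exists h. split; trivial. intros b ba. apply NNPP. intros nc. apply nb.
  exists b. split; trivial. intros c cg. apply (not_lt_le ord). intros bh. apply nc.
  now exists c.
Qed.

(** The form needed for gluing orders: fibres with at most one point are trivially ordered, and open
    fibres are clopen, so they can be treated as subspaces of their own. *)
Definition fine (g : X -> Y) : Prop :=
  isolates g /\ forall y, (forall z z', g z = y -> g z' = y -> z = z') \/
                          openX (fun z => g z = y).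

(** With no value strictly between [u] and [y], the fibre is the preimage of the half-open interval
    from [u] to [y]. *)
Lemma open_fibre_of_gap (g : X -> Y) y : cont g ->
  (exists u, u < y /\ forall z, u < g z -> g z < y -> False) -> openX (fun z => g z = y).
Proof.
  intros cg [u [uy gap]].
  apply open_ext with (fun z => g z <= y /\ u < g z).
  - apply open_and; trivial; [exact (proj1 (continuous_clopen_le ord g y cg))|now apply continuous_open_gt].
  - intros z. split.
    + intros [[L|L] L']; trivial. now destruct (gap z).
    + intros ->. split; trivial. apply le_refl.
Qed.

(** A fibre below [f x] over the least element or after a gap is open. If values accumulate at [y]
    instead, an increasing sequence below [y] copies [nat] into a proper segment of [f x], and
    regularity bounds every sequence in [f x]. *)
Lemma fine_of_countable_cofinality : ~ uncountable_cofinality lt (f x) -> fine f.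
Proof.
  intros nu. split; [apply peak|]. intros y.
  destruct (lt_total ord y (f x)) as [ya|[->|ay]].
  2:{ left. intros z z' E E'. pose proof peak as [[_ H] _].
      now rewrite (H z E), (H z' E'). }
  2:{ left. intros z z' E _. destruct (le_not_lt ord (f z) (f x)); [apply peak|].
      now rewrite E. }
  right. destruct (classic (exists u, u < y)) as [[y0 y0y]|nob].
  2:{ apply open_ext with (1 := proj1 (continuous_clopen_le ord _ y cf)).
      intros z. split.
      - intros [L|L]; trivial. destruct nob. now exists (f z).
      - intros ->. apply le_refl. }
  apply open_fibre_of_gap; [apply cf|]. apply NNPP. intros nogap. apply nu.
  destruct (choice_fun_dom _ _ y0 (fun u => u < y) (fun u v => u < v /\ v < y))
    as [nxt Hn].
  { intros u uy. apply NNPP. intros H. apply nogap. exists u. split; trivial.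
    intros z L L'. apply H. now exists (f z). }
  set (t := fun n => Nat.iter n nxt y0).
  assert (ty : forall n, t n < y).
  { intros n. induction n as [|n IH]; trivial. now apply (Hn (t n)). }
  assert (tmono : forall n k, t n < t (S (k + n))).
  { intros n k. induction k as [|k IH]; [now apply (Hn (t n))|].
    apply (lt_trans ord) with (1 := IH). apply (Hn (t (S (k + n)))), ty. }
  assert (tlt : forall n m, Peano.lt n m -> t n < t m).
  { intros n m L. destruct (Nat.le_exists_sub _ _ L) as [k [-> _]].
    rewrite Nat.add_succ_r. apply tmono. }
  assert (tinj : forall n m, t n = t m -> n = m).
  { intros n m E. destruct (Nat.lt_trichotomy n m) as [L|[L|L]]; trivial;
      apply tlt in L; rewrite E in L; now destruct (lt_irrefl ord (t m)). }
  intros h ha.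
  (* [h'] carries [h] along the injective [t]; off the range of [t] any value below [f x] will do,
     here [y]. *)
  destruct (choice_fun _ _ (fun c v => v < f x /\ forall n, t n = c -> v = h n))
    as [h' Hh'].
  { intros c. destruct (classic (exists n, t n = c)) as [[n <-]|H].
    - exists (h n). split; trivial. intros m E. now rewrite (tinj m n E).
    - exists y. split; trivial. intros n E. destruct H. now exists n. }
  destruct (minimal_peak_regular y h' ya) as [b [ba Hb]].
  - intros c _. apply Hh'.
  - exists b. split; trivial. intros n.
    rewrite <- (proj2 (Hh' (t n)) n eq_refl). auto.
Qed.

(** * Boundary points of initial segments *)

(** Exactly the topological boundary of the open set [f < xi], since its closure lies in
    [f <= xi]. *)
Definition boundary_point (xi : Y) (p : X) : Prop :=
  f p = xi /\ forall U, openX U -> U p -> exists z, U z /\ f z < xi.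

(** Let [w y] be a point of [K] with [f] above [y], and [xi] closed under [f] after [w]. Were the
    fibre over [xi] disjoint from the closure of the part of [K] below [xi], compactness would bound
    [f] on that closure by some [b < xi], and [w b] exceeds this bound. *)
Lemma closed_unbounded_meets_boundary (K : X -> Prop) :
  closed openX K -> (forall y, y < f x -> exists z, z <> x /\ K z /\ y < f z) ->
  almost_all lt (f x) (fun xi => exists p, K p /\ boundary_point xi p).
Proof.
  intros cK unb.
  destruct (choice_fun_dom _ _ x _ _ unb) as [w Hw].
  exists (fun y => f (w y)). split.
  { intros y ya. apply peak_lt. now apply Hw. }
  intros xi xa [[y0 y0x] cl].
  (* The closure of the part of [K] where [f < xi]. *)
  set (L := fun p => forall U, openX U -> U p -> exists z, U z /\ K z /\ f z < xi).
  assert (wx : forall y, y < xi -> K (w y) /\ y < f (w y)).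
  { intros y yx. apply Hw. now apply (lt_trans ord) with xi. }
  assert (Lw : forall y, y < xi -> L (w y)).
  { intros y yx U _ Uw. exists (w y). split; trivial. split; [now apply wx|auto]. }
  assert (cL : closed openX L).
  { unfold closed. apply (open_local top). intros p nL.
    apply not_all_ex_not in nL. destruct nL as [U HU].
    apply imply_to_and in HU. destruct HU as [oU HU].
    apply imply_to_and in HU. destruct HU as [Up HU].
    exists U. split; trivial. split; trivial. intros q Uq Lq. exact (HU (Lq U oU Uq)). }
  assert (Lle : forall p, L p -> f p <= xi).
  { intros p Lp. apply (not_lt_le ord). intros xp.
    destruct (Lp (fun z => xi < f z)) as [z [xz [_ zx]]]; trivial.
    - now apply continuous_open_gt.
    - apply (lt_irrefl ord xi). now apply (lt_trans ord) with (f z). }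
  destruct (classic (exists p, L p /\ f p = xi)) as [[p [Lp fp]]|none].
  - exists p. split.
    + apply NNPP. intros nK. destruct (Lp _ cK nK) as [z [nz [Kz _]]]. contradiction.
    + split; trivial. intros U oU Up. destruct (Lp U oU Up) as [z [Uz [_ fz]]].
      now exists z.
  - destruct (continuous_bounded_on_closed ord f L xi comp cf cL)
      as [H|[b [bx H]]].
    + intros p Lp. destruct (Lle p Lp) as [|E]; trivial. destruct none. now exists p.
    + destruct (H (w y0)). auto.
    + destruct (le_not_lt ord (f (w b)) b); [auto|]. now apply wx.
Qed.

(** * Fine maps in uncountable cofinality *)

Section UncountableCofinality.
Hypothesis unc : uncountable_cofinality lt (f x).

Let lim := peak_is_limit.
Let reg := minimal_peak_regular.
Local Notation AA := (almost_all lt (f x)).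

Variable s : Y -> X.
Hypothesis sP : AA (fun xi => boundary_point xi (s xi)).

(* [g] cleaves the set whose complement consists of [x] and of the [s xi], [xi] outside
   [T]. Stationarity of [T] keeps the value [g x] away from the points near [x]; then
   for almost all [xi] the sets [f < xi] and [g < m] agree near [x] for a suitable [m],
   [g] is constantly [m] on the boundary of [f < xi], and cleaving leaves only [s xi] in
   that fibre. *)
Lemma clopen_initial_segment (T : Y -> Prop) :
  ~ AA (fun xi => ~ T xi) ->
  AA (fun xi => ~ T xi -> clopen openX (fun z => f z < xi \/ z = s xi)).
Proof.
  intros statT.
  set (A := fun z => z <> x /\ (T (f z) \/ z <> s (f z))).
  destruct (cleav A) as [g [cg Hg]].
  destruct lim as [[y0 y0a] lim2].
  (* The clopen set [g x < g] misses [x], so [f] is bounded below [f x] on it. *)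
  assert (e1 : exists e, e < f x /\ forall z, g x < g z -> f z <= e).
  { destruct (continuous_bounded_on_closed ord f (fun z => g x < g z) (f x)
      comp cf) as [H|H]; trivial.
    - now apply continuous_clopen_gt.
    - intros z L. apply peak_lt. intros ->. now apply (lt_irrefl ord (g x)).
    - exists y0. split; trivial. intros z L. now destruct (H z). }
  (* Otherwise the closed fibre of [g] at [x] would contain a boundary point over almost every [xi].
     Over [xi] in [T] that point is in [A] while [x] is not, so cleaving would put almost all [xi]
     outside [T]. *)
  assert (e2 : exists e, e < f x /\ forall z, z <> x -> g z = g x -> f z <= e).
  { apply NNPP. intros H. apply statT.
    apply (almost_all_mono _ _ _ (fun xi => exists p, g p = g x /\ boundary_point xi p));
      [|apply closed_unbounded_meets_boundary].
    - intros xi xa [p [gp [fp _]]] Tx. apply (Hg p x); trivial.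
      + split; [|left; now rewrite fp]. apply lt_peak_neq. now rewrite fp.
      + intros [n _]. now apply n.
    - unfold closed. apply open_ext with (fun z => g z < g x \/ g x < g z).
      + apply open_or; trivial; [now apply continuous_open_lt|now apply continuous_open_gt].
      + intros z. split.
        * intros L E. rewrite E in L. destruct L; now apply (lt_irrefl ord (g x)).
        * intros n. destruct (lt_total ord (g z) (g x)) as [L|[E|L]]; tauto.
    - intros y ya. apply NNPP. intros n. apply H. exists y. split; trivial.
      intros z zx gz. apply (not_lt_le ord). intros yz. apply n. now exists z. }
  destruct e1 as [n1 [n1a He1]], e2 as [n2 [n2a He2]].
  destruct (max_exists ord n1 n2) as [e [n1e [n2e He]]].
  assert (ea : e < f x) by now destruct He as [->| ->].
  assert (gx : forall z, z <> x -> e < f z -> g z < g x).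
  { intros z zx ez. destruct (lt_total ord (g z) (g x)) as [L|[E|L]]; trivial.
    - destruct (lt_not_le ord e (f z) ez). apply (le_trans ord) with n2; auto.
    - destruct (lt_not_le ord e (f z) ez). apply (le_trans ord) with n1; auto. }
  (* Compactness twice: on [e < f <= y] the map [g] stays at most some [c < g x], and on the tail
     where [g <= c] the map [f] stays away from [f x]. *)
  assert (Hphi : forall y, y < f x -> exists b, b < f x /\
    forall z z', e < f z' -> f z' <= y -> e < f z -> g z <= g z' -> f z <= b).
  { intros y ya.
    destruct (continuous_bounded_on_closed ord g
      (fun z => e < f z /\ f z <= y) (g x) comp cg) as [H|[c [cx H]]].
    - apply clopen_and; trivial;
        [now apply continuous_clopen_gt|now apply continuous_clopen_le].
    - intros z [ez zy]. apply gx; trivial. apply lt_peak_neq.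
      now apply (le_lt_trans ord) with y.
    - exists y. split; trivial. intros z z' ez' zy. now destruct (H z').
    - destruct (continuous_bounded_on_closed ord f
        (fun z => e < f z /\ g z <= c) (f x) comp cf) as [H'|[b [ba H']]].
      + apply clopen_and; trivial;
          [now apply continuous_clopen_gt|now apply continuous_clopen_le].
      + intros z [_ L]. apply peak_lt. intros ->. now apply (lt_not_le ord c (g x)).
      + exists y. split; trivial. intros z z' ez' zy ez L. destruct (H' z).
        split; trivial. apply (le_trans ord) with (g z'); auto.
      + exists b. split; trivial. intros z z' ez' zy ez L. apply H'.
        split; trivial. apply (le_trans ord) with (g z'); auto. }
  destruct (choice_fun_dom _ _ y0 _ _ Hphi) as [phi Hp].
  apply (almost_all_mono _ _ _
    (fun xi => (e < xi /\ boundary_point xi (s xi)) /\ closed_under lt phi xi)).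
  2:{ apply almost_all_and; trivial.
      - apply almost_all_and; trivial. now apply almost_all_gt.
      - exists phi. split; trivial. intros y ya. now apply Hp. }
  intros xi xa [[ex [fs bs]] [_ clphi]] nT.
  (* [m] is the least strict upper bound of [g] on [e < f < xi]. As [xi] is closed under [phi],
     beyond [e] the conditions [g < m] and [f < xi] coincide. *)
  destruct (least_exists ord (fun y => forall z, e < f z -> f z < xi -> g z < y))
    as [m [m1 m2]].
  { exists (g x). intros z ez zx. apply gx; trivial. apply lt_peak_neq.
    now apply (lt_trans ord) with xi. }
  assert (gm : forall z, e < f z -> g z < m -> f z < xi).
  { intros z ez zm. apply NNPP. intros n. apply (lt_not_le ord (g z) m zm).
    apply m2. intros z' ez' zx'. apply (not_le_lt ord). intros L. apply n.
    apply (le_lt_trans ord) with (phi (f z')); auto.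
    apply Hp with z'; trivial; [now apply (lt_trans ord) with xi|apply le_refl]. }
  (* A smaller value would put [s xi] below [xi]; a larger one would persist near [s xi], where
     there are points with [f < xi] and hence [g < m]. *)
  assert (gs : g (s xi) = m).
  { destruct (lt_total ord (g (s xi)) m) as [L|[E|L]]; trivial.
    - apply gm in L; [|now rewrite fs]. rewrite fs in L. now destruct (lt_irrefl ord xi).
    - destruct (bs (fun z => m < g z /\ e < f z)) as [z [[mz ez] zx]].
      + apply open_and; trivial; now apply continuous_open_gt.
      + now rewrite fs.
      + destruct (lt_irrefl ord m). apply (lt_trans ord) with (g z); auto. }
  apply clopen_ext with (fun z => f z <= e \/ (f z <= xi /\ e < f z /\ g z <= m)).
  { apply clopen_or; trivial; [now apply continuous_clopen_le|].
    apply clopen_and; trivial; [now apply continuous_clopen_le|].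
    apply clopen_and; trivial; [now apply continuous_clopen_gt|].
    now apply continuous_clopen_le. }
  intros z. split.
  - intros [L|[[L|E] [ez L']]]; auto.
    + left. now apply (le_lt_trans ord) with e.
    (* A second point over [xi] with value [m] would lie in [A], whereas [s xi] does not because
       [xi] is outside [T]. *)
    + right. apply NNPP. intros n.
      assert (gz : g z = m).
      { destruct L' as [L'|]; trivial. apply gm in L'; trivial. rewrite E in L'.
        now destruct (lt_irrefl ord xi). }
      apply (Hg z (s xi)).
      * split; [|right; now rewrite E]. apply lt_peak_neq. now rewrite E.
      * intros [_ [H|H]]; rewrite fs in H; auto.
      * now rewrite gs.
  - intros [L| ->].
    + destruct (le_or_lt ord (f z) e) as [H|H]; auto. right.
      split; [now left|]. split; trivial. left. now apply m1.
    + right. rewrite fs, gs. split; [apply le_refl|]. split; trivial. apply le_refl.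
Qed.

Lemma fine_of_uncountable_cofinality : exists g, fine g.
Proof.
  destruct (stationary_costationary_exists Y lt (f x) ord lim reg unc) as [T [T1 T2]].
  assert (H : AA (fun xi => boundary_point xi (s xi) /\
                  clopen openX (fun z => f z < xi \/ z = s xi))).
  { apply almost_all_and; trivial.
    apply (almost_all_mono _ _ _ (fun xi =>
      (~ T xi -> clopen openX (fun z => f z < xi \/ z = s xi)) /\
      (~ ~ T xi -> clopen openX (fun z => f z < xi \/ z = s xi)))).
    - intros xi _ [H1 H2]. destruct (classic (T xi)); tauto.
    - apply almost_all_and; trivial; apply clopen_initial_segment; trivial.
      intros H. apply T1. apply almost_all_mono with (2 := H). intros xi _. tauto. }
  destruct H as [phi [Hphi HP]].
  set (C := fun c => c < f x /\ closed_under lt phi c).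
  set (Q := fun c z => f z < c \/ z = s c).
  assert (fs : forall c, C c -> f (s c) = c).
  { intros c [ca cc]. now destruct (HP c ca cc) as [[E _] _]. }
  assert (cQ : forall c, C c -> clopen openX (Q c)).
  { intros c [ca cc]. now apply HP. }
  assert (Qmono : forall c c' z, C c -> c <= c' -> Q c z -> Q c' z).
  { intros c c' z Cc [L| <-] Hz; trivial. left. destruct Hz as [Hz| ->].
    - now apply (lt_trans ord) with c.
    - now rewrite fs. }
  (* The value [f x] is the default for points in no [Q c]; only [x] will receive it, since [C] is
     unbounded in [f x]. *)
  destruct (choice_fun _ _ (fun z c => (c = f x \/ (C c /\ Q c z)) /\
    forall c', (c' = f x \/ (C c' /\ Q c' z)) -> c <= c')) as [r Hr].
  { intros z. apply (least_exists ord (fun c => c = f x \/ (C c /\ Q c z))).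
    exists (f x). now left. }
  assert (rle : forall z c, C c -> (r z <= c <-> Q c z)).
  { intros z c Cc. split.
    - intros L. destruct (proj1 (Hr z)) as [E|[Cr Qr]].
      + rewrite E in L. destruct (le_not_lt ord _ _ L). apply Cc.
      + now apply Qmono with (r z).
    - intros Qc. apply Hr. now right. }
  assert (rtop : forall z, r z <= f x).
  { intros z. apply Hr. now left. }
  assert (rC : forall z, r z < f x -> C (r z)).
  { intros z L. destruct (proj1 (Hr z)) as [E|[Cr _]]; trivial.
    rewrite E in L. now destruct (lt_irrefl ord (f x)). }
  assert (rx : r x = f x).
  { destruct (proj1 (Hr x)) as [E|[Cr [L|E]]]; trivial.
    - destruct (lt_irrefl ord (f x)). apply (lt_trans ord) with (r x); trivial. apply Cr.
    - destruct (lt_irrefl ord (f x)). rewrite E at 1. rewrite fs; trivial. apply Cr. }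
  assert (cr : cont r).
  { apply continuous_of_clopen_le; trivial. intros y.
    destruct (le_or_lt ord (f x) y) as [ay|ya].
    - apply clopen_ext with (1 := clopen_full top). intros z. split; trivial.
      intros _. now apply (le_trans ord) with (f x).
    - destruct (classic (exists c, C c /\ c <= y)) as [[c0 [Cc0 c0y]]|none].
      (* [l] is the supremum of [C] up to [y]. It belongs to [C], so [r <= y] is the clopen set
         [Q l]. *)
      + destruct (least_exists ord (fun l => forall c, C c -> c <= y -> c <= l))
          as [l [l1 l2]].
        { now exists y. }
        assert (ly : l <= y) by now apply l2.
        assert (Cl : C l).
        { split; [now apply (le_lt_trans ord) with y|]. split.
          - pose proof Cc0 as [_ [[u uc] _]]. exists u.
            apply (lt_le_trans ord) with c0; trivial. now apply l1.
          - intros u ul. apply NNPP. intros n.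
            apply (lt_not_le ord u l ul). apply l2. intros c Cc cy.
            apply (not_lt_le ord). intros uc. apply n.
            apply (lt_le_trans ord) with c; auto. now apply Cc. }
        apply clopen_ext with (1 := cQ l Cl). intros z. rewrite <- (rle z l Cl). split.
        * intros L. now apply (le_trans ord) with l.
        * intros L. apply l1; trivial. apply rC. now apply (le_lt_trans ord) with y.
      + apply clopen_ext with (1 := clopen_empty top). intros z. split; [tauto|].
        intros L. apply none. exists (r z). split; trivial. apply rC.
        now apply (le_lt_trans ord) with y. }
  assert (rfib : forall z, r z = f x -> z = x).
  { intros z E. apply NNPP. intros zx.
    destruct (closed_under_unbounded Y lt (f x) ord lim reg unc phi (f z) Hphi
      (peak_lt z zx)) as [c [ca [zc [cc _]]]].
    apply (lt_not_le ord c (f x) ca). rewrite <- E. apply rle; [now split|now left]. }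
  exists r. split; [split; trivial; now rewrite rx|].
  intros y. destruct (classic (y < f x /\ C y)) as [[ya Cy]|ny].
  2:{ left. intros z z' E E'. destruct (rtop z) as [L|L].
      - destruct ny. rewrite <- E. auto.
      - rewrite (rfib z L). symmetry. apply rfib. now rewrite E', <- E. }
  destruct (classic (exists u, u < y /\ forall z, u < r z -> r z < y -> False)) as [gap|nogap].
  { right. now apply open_fibre_of_gap. }
  (* A point of the fibre other than [s y] has [f z < y]. A value [r w] strictly between [f z] and
     [y] would put [z] in [Q (r w)], forcing [r z < y]; so there would be a gap below [y]. *)
  left. assert (H : forall z, r z = y -> z = s y).
  { intros z E. assert (Qz : Q y z) by (apply rle; trivial; right; exact E).
    destruct Qz as [L|L]; trivial. exfalso. apply nogap.
    exists (f z). split; trivial. intros w zw wy.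
    apply (lt_not_le ord (r w) y wy). rewrite <- E. apply rle; [|now left].
    apply rC. now apply (lt_trans ord) with y. }
  intros z z' E E'. now rewrite (H z E), (H z' E').
Qed.

End UncountableCofinality.
End MinimalPeak.

Theorem fine_map_exists : exists g, fine g.
Proof.
  destruct minimal_peak_exists as [f [peak minimal]].
  destruct (classic (uncountable_cofinality lt (f x))) as [unc|nunc].
  - destruct (choice_fun_dom _ _ x (fun xi => exists p, boundary_point f xi p)
      (boundary_point f) (fun xi H => H)) as [s Hs].
    apply (fine_of_uncountable_cofinality f peak minimal unc s).
    (* With the whole space as closed set, almost every [xi] has a boundary point to choose. *)
    apply (almost_all_mono _ _ _ (fun xi => exists p, True /\ boundary_point f xi p)).
    + intros xi _ [p [_ Hp]]. apply Hs. now exists p.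
    + apply closed_unbounded_meets_boundary; trivial.
      * apply (clopen_full top).
      * intros y ya. destruct (peak_not_locally_bounded f peak y ya) as [z Hz].
        exists z. tauto.
  - exists f. now apply fine_of_countable_cofinality.
Qed.

End FineMap.

(** * Well-orders with open rays and their gluing *)

Section OpenWellOrder.
Variables (X : Type) (openX : (X -> Prop) -> Prop).
Hypothesis top : is_topology openX.
Hypothesis comp : compact openX.

(* Rays within [B] are required to be open in the whole space, not only in [B], but [B]
   itself need not be open: every singleton qualifies. *)
Definition open_well_order (R : X -> X -> Prop) (B : X -> Prop) : Prop :=
  (forall z, B z -> ~ R z z) /\
  (forall u v w, B u -> B v -> B w -> R u v -> R v w -> R u w) /\
  (forall P : X -> Prop, (exists z, P z) -> (forall z, P z -> B z) ->
     exists m, P m /\ forall z, P z -> z = m \/ R m z) /\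
  (forall c, B c -> openX (fun z => B z /\ R z c) /\ openX (fun z => B z /\ R c z)).

Definition open_well_orderable (B : X -> Prop) : Prop := exists R, open_well_order R B.

Lemma open_well_orderable_subsingleton B :
  (forall z z', B z -> B z' -> z = z') -> open_well_orderable B.
Proof.
  intros H. exists (fun _ _ => False). split; [|split; [|split]]; try tauto.
  - intros P [m Pm] PB. exists m. split; auto.
  - intros c Bc. split; (apply open_ext with (1 := open_empty _ _ top); tauto).
Qed.

Lemma open_well_orderable_subset B B' :
  open_well_orderable B -> openX B' -> (forall z, B' z -> B z) -> open_well_orderable B'.
Proof.
  intros [R [irr [tr [wf op]]]] oB' sub. exists R. split; [|split; [|split]].
  - auto.
  - intros u v w Bu Bv Bw. apply tr; auto.
  - intros P nP PB. apply wf; auto.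
  - intros c Bc. destruct (op c (sub c Bc)) as [o1 o2]. split.
    + apply open_ext with (1 := open_and _ _ top _ _ oB' o1).
      intros z. specialize (sub z). tauto.
    + apply open_ext with (1 := open_and _ _ top _ _ oB' o2).
      intros z. specialize (sub z). tauto.
Qed.

Variables (Y : Type) (lt : Y -> Y -> Prop).
Hypothesis ord : is_ordinal lt.
Local Notation "x < y" := (lt x y).
Local Notation "x <= y" := (le lt x y).
Local Notation cont := (continuous openX (order_open lt)).

(** The order is lexicographic: first the value of [f], then the order of the fibre. A ray at [c] is
    the union of the part of [B] strictly on one side of [f c] and a ray inside the fibre of [c],
    both open. *)
Lemma open_well_orderable_glue (f : X -> Y) (B : X -> Prop) :
  cont f -> openX B -> (forall y, open_well_orderable (fun z => B z /\ f z = y)) ->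
  open_well_orderable B.
Proof.
  intros cf oB H. destruct (choice_fun _ _ _ H) as [R HR].
  exists (fun z z' => f z < f z' \/ (f z = f z' /\ R (f z) z z')).
  split; [|split; [|split]].
  - intros z Bz [L|[_ L]].
    + now apply (lt_irrefl ord (f z)).
    + destruct (HR (f z)) as [irr _]. now apply (irr z).
  - intros u v w Bu Bv Bw [L|[E L]] [L'|[E' L']].
    + left. now apply (lt_trans ord) with (f v).
    + left. now rewrite <- E'.
    + left. now rewrite E.
    + right. split; [congruence|]. destruct (HR (f u)) as [_ [tr _]].
      rewrite <- E in L'. apply (tr u v w); auto. split; congruence.
  - intros P [z0 Pz0] PB.
    destruct (least_exists ord (fun y => exists z, P z /\ f z = y)) as [y [[z1 [Pz1 E1]] ymin]].
    { exists (f z0), z0. auto. }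
    destruct (HR y) as [_ [_ [wf _]]].
    destruct (wf (fun z => P z /\ f z = y)) as [m [[Pm Em] mmin]].
    { now exists z1. }
    { intros z [Pz Ez]. auto. }
    exists m. split; trivial. intros z Pz.
    destruct (ymin (f z)) as [L|E].
    + now exists z.
    + right. left. now rewrite Em.
    + destruct (mmin z) as [-> |L]; auto. right. right. rewrite Em. auto.
  - intros c Bc. destruct (HR (f c)) as [_ [_ [_ op]]]. destruct (op c) as [o1 o2]; auto.
    split.
    + apply open_ext with (fun z => (B z /\ f z < f c) \/ (B z /\ f z = f c) /\ R (f c) z c).
      * apply open_or; trivial. apply open_and; trivial. now apply continuous_open_lt.
      * intros z. split.
        -- intros [[Bz L]|[[Bz E] L]]; auto. split; trivial. right. now rewrite E.
        -- intros [Bz [L|[E L]]]; auto. rewrite E in L. auto.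
    + apply open_ext with (fun z => (B z /\ f c < f z) \/ (B z /\ f z = f c) /\ R (f c) c z).
      * apply open_or; trivial. apply open_and; trivial. now apply continuous_open_gt.
      * intros z. split.
        -- intros [[Bz L]|[[Bz E] L]]; auto.
        -- intros [Bz [L|[E L]]]; auto.
Qed.

(** Glue along a two-valued continuous map constant on [A] and on its complement; the fibres are [A]
    and the part of [B] outside [A]. *)
Lemma open_well_orderable_union A B :
  infinite_type Y -> clopen openX A -> openX B ->
  open_well_orderable A -> open_well_orderable B ->
  open_well_orderable (fun z => A z \/ B z).
Proof.
  intros inf cA oB wA wB.
  destruct (inf nil) as [y0 _]. destruct (inf (y0 :: nil)) as [y1 ny].
  assert (n01 : y0 <> y1) by (intros E; apply ny; now left).
  assert (cst : cont (fun _ => y0)).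
  { apply continuous_of_clopen_le; trivial. intros c.
    destruct (classic (y0 <= c)).
    - apply clopen_ext with (1 := clopen_full top). tauto.
    - apply clopen_ext with (1 := clopen_empty top). tauto. }
  apply open_well_orderable_glue
    with (f := fun z => if excluded_middle_informative (A z) then y0 else y1).
  - now apply continuous_restrict_clopen.
  - apply open_or; trivial. apply cA.
  - intros y. destruct (classic (y = y0)) as [-> |n0]; [|destruct (classic (y = y1)) as [-> |n1]].
    + apply open_well_orderable_subset with A; trivial.
      * apply open_ext with (1 := proj1 cA). intros z.
        destruct (excluded_middle_informative (A z)); split; auto; try tauto.
        intros [_ E]. now destruct n01.
      * intros z. destruct (excluded_middle_informative (A z)); auto.
        intros [_ E]. now destruct n01.
    + apply open_well_orderable_subset with B; trivial.
      * apply open_ext with (1 := open_and _ _ top _ _ oB (proj2 cA)). intros z.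
        destruct (excluded_middle_informative (A z)); tauto.
      * intros z. destruct (excluded_middle_informative (A z)); tauto.
    + apply open_well_orderable_subsingleton. intros z z' [_ E].
      destruct n0. destruct (excluded_middle_informative (A z)); congruence.
Qed.

Definition good_point (z : X) : Prop :=
  exists N, clopen openX N /\ N z /\ open_well_orderable N.

Lemma open_well_orderable_of_good_points B :
  infinite_type Y -> clopen openX B -> (forall z, B z -> good_point z) ->
  open_well_orderable B.
Proof.
  intros inf cB good.
  (* The complement of [B] completes the good neighbourhoods to a cover of the space; the finitely
     many orderable members are then united one by one. *)
  destruct (comp (fun U => U = (fun z => ~ B z) \/ (clopen openX U /\ open_well_orderable U)))
    as [l [lF lC]].
  - intros U [-> |[H _]]; [apply cB|apply H].
  - intros z. destruct (classic (B z)) as [Bz|Bz].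
    + destruct (good z Bz) as [N [cN [Nz wN]]]. exists N. auto.
    + exists (fun z => ~ B z). auto.
  - assert (H : exists V, clopen openX V /\ open_well_orderable V /\
                  forall U z, In U l -> B z -> U z -> V z).
    { clear lC. induction l as [|U l IH].
      - exists (fun _ => False). split; [apply (clopen_empty top)|].
        split; [apply open_well_orderable_subsingleton; tauto|]. intros U z [].
      - destruct IH as [V [cV [wV HV]]].
        + intros U' HU'. apply lF. now right.
        + destruct (lF U (or_introl eq_refl)) as [-> |[cU wU]].
          * exists V. split; trivial. split; trivial.
            intros U' z [<- |HU'] Bz Uz; [tauto|now apply HV with U'].
          * exists (fun z => U z \/ V z). split; [now apply clopen_or|]. split.
            -- apply open_well_orderable_union; trivial. apply cV.
            -- intros U' z [<- |HU'] Bz Uz; [now left|right; now apply HV with U']. }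
    destruct H as [V [cV [wV HV]]].
    apply open_well_orderable_subset with V; trivial; [apply cB|].
    intros z Bz. destruct (lC z) as [U [lU Uz]]. now apply HV with U.
Qed.

Hypothesis cleav : cleavable openX (order_open lt).

(** For an isolating [f], the closed set of points outside [U] with [f <= f x] has values below
    [f x]. Compactness bounds them by some [b < f x], and [b < f <= f x] is the neighbourhood. *)
Lemma clopen_neighbourhood_exists x U :
  openX U -> U x -> exists N, clopen openX N /\ N x /\ forall z, N z -> U z.
Proof.
  intros oU Ux.
  destruct (isolating_map_exists X openX Y lt cleav x) as [f [cf fib]].
  destruct (continuous_bounded_on_closed ord f (fun z => ~ U z /\ f z <= f x) (f x) comp cf)
    as [H|[b [bx H]]].
  - unfold closed. apply open_ext with (fun z => U z \/ f x < f z).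
    + apply open_or; trivial. now apply continuous_open_gt.
    + intros z. split.
      * intros [Uz|L] [nU L']; [tauto|]. now apply (lt_not_le ord (f x) (f z)).
      * intros n. destruct (classic (U z)) as [|nU]; auto. right.
        apply (not_le_lt ord). tauto.
  - intros z [nU [L|E]]; trivial. apply fib in E. now subst.
  - exists (fun z => f z <= f x). split; [now apply continuous_clopen_le|].
    split; [apply le_refl|]. intros z L. apply NNPP. intros nU. now apply (H z).
  - exists (fun z => f z <= f x /\ b < f z). split; [|split].
    + apply clopen_and; trivial;
        [now apply continuous_clopen_le|now apply continuous_clopen_gt].
    + split; trivial. apply le_refl.
    + intros z [L bz]. apply NNPP. intros nU. apply (lt_not_le ord b (f z) bz). auto.
Qed.

Lemma clopen_isolated_point x : openX (fun z => z = x) -> clopen openX (fun z => z = x).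
Proof.
  intros o. destruct (clopen_neighbourhood_exists x _ o eq_refl) as [N [cN [Nx HN]]].
  apply clopen_ext with (1 := cN). intros z. split; auto. now intros ->.
Qed.

(** Glue along a fine map over a clopen [N] inside [U]. A fibre with several points is clopen and
    misses [x], so its part in [N] consists of good points. *)
Lemma good_point_of_punctured_neighbourhood x U :
  infinite_type Y -> openX U -> U x -> (forall z, U z -> z <> x -> good_point z) ->
  good_point x.
Proof.
  intros inf oU Ux good.
  destruct (classic (openX (fun z => z = x))) as [iso|niso].
  { exists (fun z => z = x). split; [now apply clopen_isolated_point|]. split; trivial.
    apply open_well_orderable_subsingleton. congruence. }
  destruct (clopen_neighbourhood_exists x U oU Ux) as [N [cN [Nx HN]]].
  exists N. split; trivial. split; trivial.
  destruct (fine_map_exists X openX top comp Y lt ord cleav x niso) as [f [[cf fib] Hf]].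
  apply open_well_orderable_glue with f; trivial; [apply cN|].
  intros y. destruct (Hf y) as [sub|oF].
  { apply open_well_orderable_subsingleton. intros z z' [_ E] [_ E']. auto. }
  destruct (classic (f x = y)) as [<- |ne].
  { apply open_well_orderable_subsingleton. intros z z' [_ E] [_ E'].
    now rewrite (fib z E), (fib z' E'). }
  apply open_well_orderable_of_good_points; trivial.
  - apply clopen_and; trivial. split; trivial.
    unfold closed. apply open_ext with (fun z => f z < y \/ y < f z).
    + apply open_or; trivial; [now apply continuous_open_lt|now apply continuous_open_gt].
    + intros z. split.
      * intros L E. rewrite E in L. destruct L; now apply (lt_irrefl ord y).
      * intros n. destruct (lt_total ord (f z) y) as [L|[E|L]]; tauto.
  - intros z [Nz E]. apply good; auto. intros ->. now apply ne.
Qed.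

End OpenWellOrder.

(** * Scatteredness of simple spaces *)

Lemma perfect_subset_of_derived_stage (X : Type) (openX : (X -> Prop) -> Prop)
  (P S : X -> Prop) :
  (forall z, P z -> derived openX P z) -> derived_stage openX S -> forall z, P z -> S z.
Proof.
  intros perf dS. induction dS as [|A _ IH|F _ IH _]; trivial.
  - intros z Pz. split; auto. intros U oU Uz.
    destruct (perf z Pz) as [_ H]. destruct (H U oU Uz) as [y [yz [Py Uy]]].
    exists y. auto.
  - intros z Pz A FA. now apply IH.
Qed.

(** A nonempty [P] without isolated points would survive to the stage whose only point is [xh], but
    a singleton has an isolated point. *)
Lemma simple_scattered (X : Type) (openX : (X -> Prop) -> Prop) (xh : X) (P : X -> Prop) :
  is_topology openX -> simple openX xh -> (exists z, P z) ->
  exists z U, P z /\ openX U /\ U z /\ forall y, U y -> P y -> y = z.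
Proof.
  intros top [_ [S [dS HS]]] [z0 Pz0]. apply NNPP. intros H.
  assert (perf : forall z, P z -> derived openX P z).
  { intros z Pz. split; trivial. intros U oU Uz. apply NNPP. intros n. apply H.
    exists z, U. split; trivial. split; trivial. split; trivial.
    intros y Uy Py. apply NNPP. intros yz. apply n. now exists y. }
  assert (top1 : forall z, P z -> z = xh).
  { intros z Pz. apply HS. now apply perfect_subset_of_derived_stage with openX P. }
  destruct (perf z0 Pz0) as [_ D].
  destruct (D _ (open_full top) I) as [y [yz [Py _]]]. apply yz.
  now rewrite (top1 y Py), (top1 z0 Pz0).
Qed.

(** * From an open well-order to an ordinal *)

(** The ordinal is [X] itself ordered by [R], and the homeomorphism is the identity. Open rays give
    one direction, compactness the other. *)
Lemma homeomorphic_ordinal_of_open_well_order (X : Type) (openX : (X -> Prop) -> Prop) :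
  is_topology openX -> compact openX -> open_well_orderable X openX (fun _ => True) ->
  exists (W : Type) (ltW : W -> W -> Prop),
    is_ordinal ltW /\ homeomorphic openX (order_open ltW).
Proof.
  intros top comp [R [irr [tr [wf op]]]]. exists X, R.
  assert (ordR : is_ordinal R).
  { split; [auto|]. split; [intros u v w; now apply tr|]. split.
    - intros u v. destruct (wf (fun z => z = u \/ z = v)) as [m [Hm Hmin]]; auto.
      + exists u. now left.
      + destruct (Hmin u) as [Eu|Lu], (Hmin v) as [Ev|Lv], Hm as [-> | ->]; auto;
          try (now destruct (irr _ I Lu)); try (now destruct (irr _ I Lv)).
    - intros z. apply NNPP. intros nz.
      destruct (wf (fun z => ~ Acc R z)) as [m [nm Hmin]]; auto.
      + now exists z.
      + apply nm. constructor. intros y yL. apply NNPP. intros ny.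
        destruct (Hmin y ny) as [-> |L].
        * now apply (irr m I).
        * apply (irr m I). now apply tr with y. }
  split; trivial.
  assert (cid : continuous openX (order_open R) (fun z => z)).
  { apply (continuous_of_rays top ordR); intros c; destruct (op c I) as [o1 o2].
    - apply open_ext with (1 := o1). tauto.
    - apply open_ext with (1 := o2). tauto. }
  exists (fun z => z), (fun z => z). split; trivial. split; trivial. split; trivial.
  intros U oU z Uz. split.
  (* To the left of [z], the points outside [U] form a closed set below [z], hence are bounded by
     some [b] below [z]. *)
  - destruct (continuous_bounded_on_closed ordR (fun w => w) (fun w => ~ U w /\ le R w z) z
      comp cid) as [H|[b [bz H]]].
    + unfold closed. apply open_ext with (fun w => U w \/ R z w).
      * apply open_or; trivial. now apply (continuous_open_gt ordR (fun w => w)).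
      * intros w. split.
        -- intros [Uw|L] [nU L']; [tauto|]. now apply (lt_not_le ordR z w).
        -- intros n. destruct (classic (U w)) as [|nU]; auto. right.
           apply (not_le_lt ordR). tauto.
    + intros w [nU [L|E]]; trivial. now subst.
    + right. intros w L. apply NNPP. intros nU. now apply (H w).
    + left. exists b. split; trivial. intros w bw L. apply NNPP. intros nU.
      apply (lt_not_le ordR b w bw). auto.
  (* To the right of [z], the least point outside [U] ends the interval. *)
  - destruct (classic (exists w, ~ U w /\ le R z w)) as [ex|none].
    + destruct (least_exists ordR _ ex) as [b [[nb zb] bmin]]. left. exists b. split.
      * destruct zb as [|E]; trivial. now subst.
      * intros w zw wb. apply NNPP. intros nU. apply (lt_not_le ordR w b wb). auto.
    + right. intros w zw. apply NNPP. intros nU. apply none. now exists w.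
Qed.

Theorem theorem1p15 (X : Type) (openX : (X -> Prop) -> Prop)
  (Y : Type) (ltY : Y -> Y -> Prop) (xh : X) :
  is_topology openX ->
  is_ordinal ltY -> infinite_type Y ->
  infinite_type X -> compact openX -> simple openX xh ->
  cleavable openX (order_open ltY) ->
  hereditarily_has_spine openX ltY ->
  exists (W : Type) (ltW : W -> W -> Prop),
    is_ordinal ltW /\ homeomorphic openX (order_open ltW).
Proof.
  intros top ord infY _ comp simp cleav _.
  apply homeomorphic_ordinal_of_open_well_order; trivial.
  apply (open_well_orderable_of_good_points X openX top comp Y ltY ord); trivial.
  { now apply clopen_full. }
  intros z0 _. apply NNPP. intros bad0.
  (* If bad points exist, one of them is isolated among them; it has a punctured neighbourhood of
     good points and is therefore good. *)
  destruct (simple_scattered X openX xh (fun z => ~ good_point X openX z) top simp)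
    as [z [U [bad [oU [Uz iso]]]]].
  { now exists z0. }
  apply bad. apply (good_point_of_punctured_neighbourhood X openX top comp Y ltY ord cleav z U);
    trivial.
  intros y Uy yz. apply NNPP. intros ny. apply yz. now apply iso.
Qed.
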